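(* Let $\tilde{1}(n)=1/n$. The double sequences $\mathcal{A}^{1,\mathrm{id}}$ and $\mathcal{A}^{\tilde 1,1}$ are both horizontally log-concave, and neither of them is vertically log-concave.
   Context: Here $\mathbb{N}=\{1,2,3,\dots\}$, and $1$ and $\mathrm{id}$ denote the arithmetic functions $1(n)=1$, $\mathrm{id}(n)=n$. For positive real-valued arithmetic functions $g,h$ on $\mathbb{N}$ with $g(1)=h(1)=1$, the polynomials $P_n^{g,h}(x)$ are defined by $P_0^{g,h}(x)=1$ and $P_n^{g,h}(x)=\frac{x}{h(n)}\sum_{k=1}^{n} g(k)\,P_{n-k}^{g,h}(x)$ for $n\ge 1$. For $n\ge1$ write $P_n^{g,h}(x)=\sum_{m=1}^n A_{n,m}^{g,h}x^m$. The double sequence $\mathcal{A}^{g,h}=\{a_{n,m}^{g,h}\}$ is defined by $a_{n,m}^{g,h}=A_{n,m}^{g,h}$ for $1\le m\le n$ and $a_{n,m}^{g,h}=0$ otherwise. A sequence $\{a_n\}_{n\ge0}$ of non-negative reals is log-concave if $a_n^2\ge a_{n-1}a_{n+1}$ for all $n\ge1$. A double sequence $\{a_{n,m}\}$ is horizontally log-concave if for every $n_0\in\mathbb{N}$ the sequence $\{a_{n_0,m}\}_m$ is log-concave, and vertically log-concave if for every $m_0\in\mathbb{N}$ the sequence $\{a_{n,m_0}\}_n$ is log-concave. *)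

(* Defs.v *)
From mathcomp Require Import all_boot all_order all_algebra.
From mathcomp Require Import reals.

Set Implicit Arguments.
Unset Strict Implicit.
Unset Printing Implicit Defensive.
Import Order.TTheory GRing.Theory Num.Theory.
Local Open Scope ring_scope.

Section Polynomials.
Variable R : realType.

(* An arithmetic function on {1, 2, ...} is a map nat -> R; its value at 0 is
   never used. *)
Definition arith_one : nat -> R := fun=> 1.
Definition arith_id : nat -> R := fun n => n%:R.
Definition arith_inv : nat -> R := fun n => n%:R^-1.

Definition normalized_positive (f : nat -> R) : Prop :=
  f 1%N = 1 /\ forall n, (1 <= n)%N -> 0 < f n.

Variables g h : nat -> R.

(* The list [:: P_0; ...; P_n]: a course-of-values recursion for P_n below,
   whose defining equations are polP0 and polPE. *)
Fixpoint polP_list (n : nat) : seq {poly R} :=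
  if n is n'.+1 then
    let s := polP_list n' in
    rcons s ((h n)^-1 *: ('X * \sum_(1 <= k < n.+1) g k *: s`_(n - k)))
  else [:: 1].

Definition polP (n : nat) : {poly R} := (polP_list n)`_n.

Definition coefA (n m : nat) : R := (polP n)`_m.

Definition doubleA (n m : nat) : R :=
  if (1 <= m <= n)%N then coefA n m else 0.

Lemma size_polP_list n : size (polP_list n) = n.+1.
Proof. by elim: n => //= n IHn; rewrite size_rcons IHn. Qed.

Lemma nth_polP_list n i : (i <= n)%N -> (polP_list n)`_i = polP i.
Proof.
elim: n => [|n IHn]; first by rewrite leqn0 => /eqP->.
rewrite leq_eqVlt => /predU1P[-> //|lt_in] /=.
by rewrite nth_rcons size_polP_list lt_in IHn.
Qed.

Lemma polP0 : polP 0 = 1.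
Proof. by []. Qed.

Lemma polPE n : (1 <= n)%N ->
  polP n = (h n)^-1 *: ('X * \sum_(1 <= k < n.+1) g k *: polP (n - k)).
Proof.
case: n => // n _; rewrite {1}/polP /= nth_rcons size_polP_list ltnn eqxx.
congr (_ *: (_ * _)); apply: eq_big_nat => k /andP[k_gt0 _].
by rewrite nth_polP_list // leq_subLR -(addn1 n) addnC leq_add2r.
Qed.

Lemma polP_coefA n : (1 <= n)%N ->
  polP n = \sum_(1 <= m < n.+1) coefA n m *: 'X^m.
Proof.
have size_P i : (size (polP i) <= i.+1)%N.
  elim/ltn_ind: i => -[_|i IHi]; first by rewrite polP0 size_poly1.
  rewrite polPE // (leq_trans (size_scale_leq _ _)) //.
  rewrite mulrC (leq_trans (size_polyMleq _ _)) // size_polyX addn2 /= ltnS.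
  rewrite big_nat; apply: (leq_trans (size_sum _ _ _)).
  apply/bigmax_leqP_seq => k _ /andP[k_gt0 _].
  rewrite (leq_trans (size_scale_leq _ _)) //.
  have lt_k : (i.+1 - k < i.+1)%N by rewrite ltn_subrL k_gt0.
  exact: leq_trans (IHi _ lt_k) lt_k.
move=> n_gt0; apply/polyP => j.
have P0 : (polP n)`_0 = 0 by rewrite polPE // coefZ coefXM mulr0.
rewrite -[LHS]/(coefA n j) coef_sum.
under eq_bigr do rewrite coefZ coefXn.
case: (boolP (1 <= j < n.+1)%N) => [j_in|].
  rewrite (bigD1_seq j) ?mem_index_iota ?iota_uniq //= eqxx mulr1.
  by rewrite big1 ?addr0 // => i; rewrite eq_sym => /negPf->; rewrite mulr0.
move=> j_out; rewrite big_nat big1 => [|i i_in].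
  case: j j_out => [//|j]; rewrite /= -leqNgt => le_nj.
  by rewrite /coefA nth_default // (leq_trans (size_P n)).
by case: eqP => [eji|_]; rewrite ?mulr0 //; move: j_out; rewrite eji i_in.
Qed.

Lemma doubleA_ge0 : normalized_positive g -> normalized_positive h ->
  forall n m, 0 <= doubleA n m.
Proof.
move=> [_ g_gt0] [_ h_gt0].
have P_ge0 n m : 0 <= (polP n)`_m.
  elim/ltn_ind: n m => -[_ m|n IHn m]; first by rewrite polP0 coef1 ler0n.
  rewrite polPE // coefZ coefXM; apply: mulr_ge0.
    by rewrite invr_ge0; apply/ltW/h_gt0.
  case: ifP => // _; rewrite coef_sum big_nat sumr_ge0 // => k /andP[k_gt0 _].
  rewrite coefZ; apply: mulr_ge0; first by apply/ltW/g_gt0.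
  by apply: IHn; rewrite ltn_subrL k_gt0.
move=> n m; rewrite /doubleA; case: ifP => _; first exact: P_ge0.
exact: lexx.
Qed.

End Polynomials.

Section LogConcavity.
Variable R : realType.

(* Log-concavity is a property of non-negative sequences. By doubleA_ge0 the
   first conjunct always holds for the double sequences above. *)
Definition log_concave (a : nat -> R) : Prop :=
  (forall n, 0 <= a n) /\
  (forall n, (1 <= n)%N -> a n ^+ 2 >= a n.-1 * a n.+1).

Definition horizontally_log_concave (a : nat -> nat -> R) : Prop :=
  forall n0, (1 <= n0)%N -> log_concave (fun m => a n0 m).

Definition vertically_log_concave (a : nat -> nat -> R) : Prop :=
  forall m0, (1 <= m0)%N -> log_concave (fun n => a n m0).

End LogConcavity.

Section Normalized.
Variable R : realType.

Lemma arith_one_normalized : normalized_positive (@arith_one R).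
Proof. by split=> // n _; exact: ltr01. Qed.

Lemma arith_id_normalized : normalized_positive (@arith_id R).
Proof. by split=> // n n_gt0; rewrite /arith_id ltr0n. Qed.

Lemma arith_inv_normalized : normalized_positive (@arith_inv R).
Proof.
by split=> [|n n_gt0]; rewrite /arith_inv ?invr1 // invr_gt0 ltr0n.
Qed.

End Normalized.

(* Main.v *)
Require Import Defs.
From mathcomp Require Import all_boot all_order all_algebra.
From mathcomp Require Import reals.
From mathcomp Require Import zify ring lra.

(** The polynomials P_n of the pair (1, id) satisfy the two-term recursion
    (n+1) P_(n+1) = (x + n) P_n, so that P_n is the rising factorial
    x (x+1) ... (x+n-1) / n!, whose coefficients are c(n,m) / n! with c(n,m) the
    unsigned Stirling numbers of the first kind. As their generating series in q
    is (1 - q)^(-x), differentiating in x multiplies it by -log(1 - q), whose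
    coefficients are the values 1/k of the other function g: this is
    [deriv_polP_one_id]. Read coefficientwise, it says that m! times the
    coefficients of P_n obey the recursion defining the array of the pair
    (1/n, 1). Hence the entries of the second array are m! times those of the
    first ([coefA_inv_one]). In terms of series, with L = -log(1 - q): the
    coefficient of x^m is L^m / m! in (1 - q)^(-x), and L^m in the series
    1 / (1 - x L) of the second pair.

    Horizontal log-concavity therefore only has to be proved for the second
    array: dividing a log-concave sequence by m! keeps it log-concave
    ([log_concave_of_fact]). For the second array it is an induction on n along
    the two-term recursion, because multiplying p by x + c with c >= 0 preserves
    log-concavity of the sequence m! p_m ([log_concave_fact_mulXaddC]). This
    plays the part of the inequalities of Newton for real-rooted polynomials.

    Vertical log-concavity fails already in the first column, which is 1/n in
    both arrays: (1/2)^2 < 1 * (1/3). *)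

Set Implicit Arguments.
Unset Strict Implicit.
Unset Printing Implicit Defensive.
Import Order.TTheory GRing.Theory Num.Theory.
Local Open Scope ring_scope.

(** * Log-concave sequences and multiplication by x + c *)

Section LogConcaveSequences.
Variable R : realType.
Implicit Types (u : nat -> R) (p : {poly R}).

Lemma eq_log_concave u v : u =1 v -> log_concave u -> log_concave v.
Proof.
move=> uv [u0 uS]; split=> [n|n n1]; rewrite -!uv; first exact: u0.
exact: uS.
Qed.

Lemma log_concave_scale (c : R) u :
  0 <= c -> log_concave u -> log_concave (fun n => c * u n).
Proof.
move=> c0 [u0 uS]; split=> [n|n n1]; first exact: mulr_ge0.
by rewrite exprMn mulrACA -expr2 ler_wpM2l ?exprn_ge0 ?uS.
Qed.

(** Multiply the two log-concavity inequalities centred at i+1 and i+2 and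
    cancel u_(i+1) u_(i+2). This needs these two terms to be positive, which is
    why the support has to be an interval: 1, 0, 0, 1 is log-concave. *)
Lemma log_concave_outer u l r i :
  (forall j, (0 < u j) = (l <= j <= r)%N) -> log_concave u ->
  u i * u i.+3 <= u i.+1 * u i.+2.
Proof.
move=> supp [u0 uS].
have [->|] := eqVneq (u i * u i.+3) 0; first exact: mulr_ge0.
rewrite mulf_eq0 negb_or => /andP[nz0 nz3].
have {nz0 nz3} [pos0 pos3] : 0 < u i /\ 0 < u i.+3.
  by rewrite !lt0r nz0 nz3 !u0.
have [u1 u2] : 0 < u i.+1 /\ 0 < u i.+2.
  by move: pos0 pos3; rewrite !supp; lia.
have /= le1 := uS i.+1 isT; have /= le2 := uS i.+2 isT.
rewrite -(ler_pM2r (mulr_gt0 u1 u2)).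
have -> : u i * u i.+3 * (u i.+1 * u i.+2)
  = (u i * u i.+2) * (u i.+1 * u i.+3) by ring.
have -> : u i.+1 * u i.+2 * (u i.+1 * u i.+2)
  = u i.+1 ^+ 2 * u i.+2 ^+ 2 by ring.
by apply: ler_pM; rewrite ?mulr_ge0.
Qed.

(** With u_i = i! p_i, the new sequence is v_i = i u_(i-1) + c u_i. Expanding
    v_i^2 - v_(i-1) v_(i+1) in powers of c, each coefficient is non-negative:
    those of 1 and c^2 by log-concavity of u, and that of c by comparing
    the products u_(i-1) u_i and u_(i-2) u_(i+1). *)
Lemma log_concave_fact_mulXaddC p c l r :
  0 <= c -> (forall i, (0 < p`_i) = (l <= i <= r)%N) ->
  log_concave (fun i => i`!%:R * p`_i) ->
  log_concave (fun i => i`!%:R * (('X + c%:P) * p)`_i).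
Proof.
move=> c0 supp lc; set u := fun i : nat => _ in lc.
have suppu i : (0 < u i) = (l <= i <= r)%N.
  by rewrite /u pmulr_rgt0 ?supp // ltr0n fact_gt0.
have outer i := log_concave_outer i suppu lc.
have [u0 uS] := lc.
pose v i := i%:R * u i.-1 + c * u i.
apply: (@eq_log_concave v) => [i|].
  rewrite /v /u mulrDl coefD coefXM coefCM.
  case: i => [|i] /=; first by rewrite mul0r !add0r; ring.
  by rewrite factS natrM; ring.
have v0 i : 0 <= v i by apply: addr_ge0; apply: mulr_ge0 => //; apply: u0.
split=> // -[//|[|i] _] /=.
  rewrite /v /= mul0r add0r mul1r.
  have /= le1 := uS 1%N isT.
  have := ler_wpM2l (mulr_ge0 c0 c0) le1.
  have := sqr_ge0 (u 0%N); nra.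
have /= le1 := uS i.+1 isT; have /= le2 := uS i.+2 isT.
have le3 := outer i.
have i0 : 0 <= i%:R :> R by apply: ler0n.
(* The successors are expanded in m = i so that the identity is polynomial. *)
rewrite /v /= -subr_ge0 -[i.+3%:R]natr1 -[i.+2%:R]natr1 -[i.+1%:R]natr1.
set m : R := i%:R in i0 *.
have -> : ((m + 1 + 1) * u i.+1 + c * u i.+2) ^+ 2 -
   ((m + 1) * u i + c * u i.+1) * ((m + 1 + 1 + 1) * u i.+2 + c * u i.+3)
  = u i.+1 ^+ 2 + (m + 1) * (m + 3) * (u i.+1 ^+ 2 - u i * u i.+2)
    + c * (m + 1) * (u i.+1 * u i.+2 - u i * u i.+3)
    + c ^+ 2 * (u i.+2 ^+ 2 - u i.+1 * u i.+3) by ring.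
rewrite !addr_ge0 ?sqr_ge0 //; apply: mulr_ge0; rewrite ?subr_ge0 ?sqr_ge0 //.
  by apply: mulr_ge0; apply: addr_ge0.
by apply: mulr_ge0 => //; apply: addr_ge0.
Qed.

(** After cancelling factorials, the hypothesis carries the extra factor
    (i+2) / (i+1) >= 1 on the side of u_i u_(i+2). *)
Lemma log_concave_of_fact u :
  log_concave (fun i => i`!%:R * u i) -> log_concave u.
Proof.
move=> [f0 fS].
have F i : 0 < i`!%:R :> R by rewrite ltr0n fact_gt0.
have u0 i : 0 <= u i by have := f0 i; rewrite pmulr_rge0.
split=> // -[//|i] _ /=; have /= := fS i.+1 isT.
rewrite !factS !natrM; move: (F i) (mulr_ge0 (u0 i) (u0 i.+2)) => Fi.
set w := u i * u i.+2 => w0.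
have -> : i`!%:R * u i * (i.+2%:R * (i.+1%:R * i`!%:R) * u i.+2)
  = (i.+1%:R * i`!%:R ^+ 2) * (i.+2%:R * w) by rewrite /w; ring.
have -> : (i.+1%:R * i`!%:R * u i.+1) ^+ 2
  = (i.+1%:R * i`!%:R ^+ 2) * (i.+1%:R * u i.+1 ^+ 2) by ring.
rewrite ler_pM2l ?mulr_gt0 ?exprn_gt0 // => le1.
rewrite -(ler_pM2l (ltr0Sn R i)); apply: le_trans le1.
by rewrite ler_wpM2r // ler_nat.
Qed.

End LogConcaveSequences.

(** * Coefficients of the two families of polynomials *)

Section Polynomials.
Variable R : realType.

Lemma doubleA_coefA (g h : nat -> R) n m :
  (1 <= n)%N -> doubleA g h n m = coefA g h n m.
Proof.
move=> n1; rewrite /doubleA; case: ifPn => // mn.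
rewrite /coefA polP_coefA // coef_sum big_nat big1 // => i i_in.
rewrite coefZ coefXn; case: eqP => [emi|_]; rewrite ?mulr0 //.
by move: mn; rewrite emi i_in.
Qed.

Local Notation Q := (polP (@arith_one R) (@arith_id R)).
Local Notation A := (coefA (@arith_one R) (@arith_id R)).

Lemma polP_one_idE n :
  n%:R *: Q n = 'X * \sum_(0 <= j < n) Q j.
Proof.
case: n => [|n]; first by rewrite scale0r big_geq // mulr0.
rewrite polPE // scalerA mulfV ?pnatr_eq0 // scale1r; congr (_ * _).
rewrite big_add1 /= big_nat_rev /= add0n.
by apply: eq_big_nat => k k_lt; rewrite scale1r subnS subSn ?subKn //; lia.
Qed.

(** Compare the sums giving n P_n and (n+1) P_(n+1): they differ by x P_n. *)
Lemma polP_one_idS n : n.+1%:R *: Q n.+1 = ('X + n%:R%:P) * Q n.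
Proof.
rewrite polP_one_idE big_nat_recr //= mulrDr -polP_one_idE mulrDl addrC.
by rewrite mul_polyC.
Qed.

(** The x-derivative of (1 - q)^(-x) is -log(1 - q) (1 - q)^(-x). To stay with
    polynomials, differentiate the two-term recursion and use induction; the
    sums match thanks to (n+1)/k = (n+1-k)/k + 1. *)
Lemma deriv_polP_one_id n :
  (Q n)^`() = \sum_(1 <= k < n.+1) k%:R^-1 *: Q (n - k).
Proof.
elim: n => [|n IHn]; first by rewrite polP0 big_geq // derivC.
have nz : n.+1%:R != 0 :> R by rewrite pnatr_eq0.
apply: (scalerI nz); rewrite -derivZ polP_one_idS derivM derivD derivX derivC.
rewrite addr0 mul1r IHn mulr_sumr scaler_sumr.
under [RHS]eq_big_nat => k k_in.
  have -> : n.+1%:R *: (k%:R^-1 *: Q (n.+1 - k)) =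
     k%:R^-1 *: ((n.+1 - k)%:R *: Q (n.+1 - k)) + Q (n.+1 - k).
    have nzk : k%:R != 0 :> R by rewrite pnatr_eq0; lia.
    rewrite !scalerA -{3}[Q _]scale1r -scalerDl natrB ?(andP k_in).2; last lia.
    by congr (_ *: _); field.
  over.
(* The first sum has a zero last term; the second starts with Q n. *)
rewrite big_split /= [in RHS]big_nat_recr //= subnn scale0r scaler0 addr0.
rewrite [X in _ = _ + X]big_nat_recl //= subSS subn0 addrCA; congr (_ + _).
rewrite -big_split /=; apply: eq_big_nat => k k_in.
rewrite subSS subSn; last lia.
rewrite polP_one_idS -scalerAr.
have nzk : k%:R != 0 :> R by rewrite pnatr_eq0; lia.
rewrite -[X in _ = _ + X](scalerK nzk) -scalerDr; congr (_ *: _).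
rewrite -mul_polyC -mulrDl -addrA -polyCD -natrD subnK //; lia.
Qed.

(** The coefficient of x^m in the derivative is (m+1) P_(n,m+1), and the factor
    m+1 is what turns m! into (m+1)!. *)
Lemma coefA_inv_one n m :
  coefA (@arith_inv R) (@arith_one R) n m = m`!%:R * A n m.
Proof.
elim/ltn_ind: n m => -[_|n IHn] m.
  by rewrite /coefA !polP0 coef1; case: m => [|m]; rewrite ?mulr0 ?mul1r.
rewrite {1}/coefA polPE // /arith_one invr1 scale1r coefXM.
case: m => [|m] /=; first by rewrite /coefA polPE // coefZ coefXM !mulr0.
have -> : m.+1`!%:R * A n.+1 m.+1 = m`!%:R * (Q n.+1)^`()`_m.
  by rewrite coef_deriv -mulr_natr factS natrM /coefA; ring.
rewrite deriv_polP_one_id !coef_sum mulr_sumr.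
apply: eq_big_nat => k k_in; rewrite !coefZ -[_`_m]/(coefA _ _ _ m).
rewrite IHn; last lia.
exact: mulrCA.
Qed.

Lemma coefA_one_idS n m :
  n.+1%:R * A n.+1 m.+1 = A n m + n%:R * A n m.+1.
Proof. by rewrite /coefA -coefZ polP_one_idS mulrDl coefD coefXM coefCM. Qed.

Lemma coefA_one_id_ge0 n m : 0 <= A n m.
Proof.
case: n => [|n]; first by rewrite /coefA polP0 coef1 ler0n.
rewrite -doubleA_coefA //.
exact: doubleA_ge0 (arith_one_normalized R) (arith_id_normalized R) _ _.
Qed.

(** The lower bound is written as a boolean so that P_0 = 1, supported at 0,
    is covered together with n > 0, where the support is 1, ..., n. *)
Lemma coefA_one_id_gt0 n m : (0 < A n m) = ((0 < n)%N <= m <= n)%N.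
Proof.
elim: n m => [|n IHn] m; first by rewrite /coefA polP0 coef1 ltr0n; case: m.
case: m => [|m]; first by rewrite /coefA polPE // coefZ coefXM mulr0 ltxx.
rewrite -(pmulr_rgt0 _ (ltr0Sn R n)) coefA_one_idS lt0r paddr_eq0;
  rewrite ?addr_ge0 ?mulr_ge0 ?coefA_one_id_ge0 // andbT mulf_eq0 pnatr_eq0.
have pos k : (A n k == 0) = ~~ ((0 < n)%N <= k <= n)%N.
  by rewrite -IHn lt0r coefA_one_id_ge0 andbT negbK.
rewrite !pos; lia.
Qed.

Lemma log_concave_fact_coefA_one_id n :
  log_concave (fun m => m`!%:R * A n m).
Proof.
elim: n => [|n IHn].
  split=> [m|[//|m] _]; rewrite /coefA polP0 !coef1; first exact: mulr_ge0.
  by rewrite /= !mulr0 sqr_ge0.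
apply: (@eq_log_concave _ (fun m => n.+1%:R^-1 *
    (m`!%:R * (('X + n%:R%:P) * Q n)`_m))) => [m|].
  by rewrite -polP_one_idS coefZ mulrCA mulKf ?pnatr_eq0.
apply: log_concave_scale; first by rewrite invr_ge0.
apply: log_concave_fact_mulXaddC IHn => //.
exact: coefA_one_id_gt0.
Qed.

Lemma coefA_one_id1 n : A n.+1 1 = n.+1%:R^-1.
Proof.
have nz k : k.+1%:R != 0 :> R by rewrite pnatr_eq0.
elim: n => [|n IHn].
  apply: (mulfI (nz 0%N)); rewrite mulfV // coefA_one_idS.
  by rewrite /coefA polP0 !coef1 mul0r addr0.
apply: (mulfI (nz n.+1)); rewrite mulfV // coefA_one_idS.
by rewrite IHn mulfV // {1}/coefA polPE // coefZ coefXM mulr0 add0r.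
Qed.

(** The column 1/n is strictly log-convex; the indices 1, 2, 3 suffice. *)
Lemma not_vertically_log_concave_inv (a : nat -> nat -> R) :
  (forall n, a n.+1 1%N = n.+1%:R^-1) -> ~ vertically_log_concave a.
Proof.
move=> a1 /(_ 1%N isT)[_ /(_ 2%N isT)] /=.
rewrite !a1 leNgt => /negP; apply; lra.
Qed.

End Polynomials.

Theorem proposition3 (R : realType) :
  (horizontally_log_concave (doubleA (@arith_one R) (@arith_id R)) /\
   horizontally_log_concave (doubleA (@arith_inv R) (@arith_one R))) /\
  (~ vertically_log_concave (doubleA (@arith_one R) (@arith_id R)) /\
   ~ vertically_log_concave (doubleA (@arith_inv R) (@arith_one R))).
Proof.
have lc n := log_concave_fact_coefA_one_id R n.
split; split.
- move=> n n1; apply: eq_log_concave (log_concave_of_fact (lc n)) => m.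
  by rewrite doubleA_coefA.
- move=> n n1; apply: eq_log_concave (lc n) => m.
  by rewrite doubleA_coefA // coefA_inv_one.
- apply: not_vertically_log_concave_inv => n.
  by rewrite doubleA_coefA // coefA_one_id1.
apply: not_vertically_log_concave_inv => n.
by rewrite doubleA_coefA // coefA_inv_one mul1r coefA_one_id1.
Qed.
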